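(* Let $\{\mathfrak{n}=V\oplus\mathfrak{g},B^*\}$ be the complex 2-step nilpotent Lie algebra described in the context, let $\mathfrak{h}$ be a Cartan subalgebra of $\mathfrak{g}$, let $\lambda\in\Lambda$, and let $v_\lambda$ be any element of $V_\lambda$. Then (with $\mathrm{ad}$ taken in $\mathfrak{n}$) $$\mathrm{ad}\,v_\lambda(V)\subset \mathbb{C}t_\lambda+\mathfrak{g}_\lambda+\sum_{\alpha\in\Phi_\lambda}\mathfrak{g}_\alpha .$$ Equality holds if $v_\lambda\in V_\lambda-\Sigma_\lambda$.
   Context: $\mathfrak{g}$ is a complex semisimple Lie algebra and $V$ is a finite dimensional complex $\mathfrak{g}$-module. $B^*$ is a nondegenerate symmetric complex bilinear form on $\mathfrak{n}=V\oplus\mathfrak{g}$ such that $V$ and $\mathfrak{g}$ are $B^*$-orthogonal, $B^*(Xv,v')+B^*(v,Xv')=0$ for $v,v'\in V$, $X\in\mathfrak{g}$, and $B^*(\mathrm{ad}X(Y),Z)+B^*(Y,\mathrm{ad}X(Z))=0$ for $X,Y,Z\in\mathfrak{g}$ (with $\mathrm{ad}$ of $\mathfrak{g}$). The bracket of $\mathfrak{n}$ is defined by: $\mathfrak{g}$ is central in $\mathfrak{n}$, $[\mathfrak{n},\mathfrak{n}]\subseteq\mathfrak{g}$, and $B^*([v,v'],Z)=B^*(Zv,v')$ for $v,v'\in V$, $Z\in\mathfrak{g}$. $\Phi$ is the root system of $\mathfrak{h}$, $\mathfrak{g}_\alpha$ ($\alpha\in\Phi$) the root spaces, and $\mathfrak{g}_\mu=\{0\}$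 for $\mu\notin\Phi$. $\Lambda\subset \mathrm{Hom}(\mathfrak{h},\mathbb{C})$ is the set of nonzero weights of $V$, with weight spaces $V_\lambda=\{v\in V:Hv=\lambda(H)v\ \forall H\in\mathfrak{h}\}$; $V_0$ is the zero weight space. $t_\lambda\in\mathfrak{h}$ is the element with $B^*(H,t_\lambda)=\lambda(H)$ for all $H\in\mathfrak{h}$. $\Phi_\lambda=\{\alpha\in\Phi: V_{\lambda-\alpha}\neq\{0\}\}$. For each $\alpha\in\Phi$ let $X_{-\alpha}$ be a nonzero element of the one-dimensional space $\mathfrak{g}_{-\alpha}$, and let $\mathrm{Ker}(X_{-\alpha})$ denote the kernel of $X_{-\alpha}:V_\lambda\to V_{\lambda-\alpha}$. If $\lambda\in\Lambda\cap\Phi$, set $\Sigma_\lambda=\mathrm{Ker}(X_{-\lambda})\cup\bigcup_{\alpha\in\Phi_\lambda}\mathrm{Ker}(X_{-\alpha})\subset V_\lambda$; if $\lambda\notin\Lambda\cap\Phi$, set $\Sigma_\lambda=\bigcup_{\alpha\in\Phi_\lambda}\mathrm{Ker}(X_{-\alpha})\subset V_\lambda$. *)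

(* Defs.v *)
From HB Require Import structures.
From mathcomp Require Import all_boot all_order all_algebra.
From mathcomp Require Import all_classical reals complex.
Set Implicit Arguments.
Unset Strict Implicit.
Unset Printing Implicit Defensive.
Import GRing.Theory.
Local Open Scope classical_set_scope.
Local Open Scope ring_scope.

Record lie_algebra (F : fieldType) (g : vectType F) := LieAlgebra {
  lie_bracket :> {bilinear g -> g -> g};
  lie_alternating : forall x, lie_bracket x x = 0;
  lie_jacobi : forall x y z,
    lie_bracket x (lie_bracket y z) + lie_bracket y (lie_bracket z x)
    + lie_bracket z (lie_bracket x y) = 0
}.

Record lie_module (F : fieldType) (g : vectType F) (L : lie_algebra g)
    (V : vectType F) := LieModule {
  lie_action :> {bilinear g -> V -> V};
  lie_actionP : forall x y v,
    lie_action (L x y) v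
    = lie_action x (lie_action y v) - lie_action y (lie_action x v)
}.

Section LieNotions.
Variables (F : fieldType) (g : vectType F) (L : lie_algebra g).

Definition is_lie_ideal (I : {vspace g}) : Prop :=
  forall x y, y \in I -> L x y \in I.

Definition derived_space (U : {vspace g}) : {vspace g} :=
  <<[seq L x y | x <- vbasis U, y <- vbasis U]>>%VS.

Definition is_solvable (U : {vspace g}) : Prop :=
  exists n, iter n derived_space U = 0%VS.

Definition is_semisimple : Prop :=
  forall I : {vspace g}, is_lie_ideal I -> is_solvable I -> I = 0%VS.

Definition is_abelian (U : {vspace g}) : Prop :=
  forall x y, x \in U -> y \in U -> L x y = 0.

Definition ad_diagonalizable (x : g) : Prop :=
  exists2 b : seq g, basis_of fullv b
    & forall y, y \in b -> exists a : F, L x y = a *: y.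

(* The definition used for complex semisimple Lie algebras: a maximal abelian
   subalgebra all of whose elements are ad-semisimple, that is (the field being
   algebraically closed) ad-diagonalizable. *)
Definition is_cartan (h : {vspace g}) : Prop :=
  [/\ is_abelian h,
      forall k : {vspace g}, (h <= k)%VS -> is_abelian k -> k = h
    & forall x, x \in h -> ad_diagonalizable x].

End LieNotions.

Section Weights.
Variables (F : fieldType) (g : vectType F) (L : lie_algebra g).
Variables (V : vectType F) (rho : lie_module L V) (h : {vspace g}).
Implicit Types (mu lambda alpha : 'Hom(subvs_of h, F^o)).

Definition weight_space mu : set V :=
  [set v | forall H : subvs_of h, rho (vsval H) v = mu H *: v].

Definition nonzero_weights : set 'Hom(subvs_of h, F^o) :=
  [set mu | mu <> 0 /\ weight_space mu <> [set 0]].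

Definition ad_weight_space mu : set g :=
  [set x | forall H : subvs_of h, L (vsval H) x = mu H *: x].

Definition root_system : set 'Hom(subvs_of h, F^o) :=
  [set alpha | alpha <> 0 /\ ad_weight_space alpha <> [set 0]].

Definition root_space mu : set g :=
  if mu \in root_system then ad_weight_space mu else [set 0].

Definition roots_below lambda : set 'Hom(subvs_of h, F^o) :=
  [set alpha | root_system alpha /\ weight_space (lambda - alpha) <> [set 0]].

(* [X alpha] stands for the chosen nonzero vector $X_\alpha$ of the root space
   of alpha. *)
Definition weight_ker (X : 'Hom(subvs_of h, F^o) -> g) lambda alpha : set V :=
  [set v | weight_space lambda v /\ rho (X (- alpha)) v = 0].

Definition singular_set (X : 'Hom(subvs_of h, F^o) -> g) lambda : set V :=
  (if lambda \in nonzero_weights `&` root_system then weight_ker X lambda lambda else set0)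
  `|` \bigcup_(alpha in roots_below lambda) weight_ker X lambda alpha.

End Weights.

Arguments nonzero_weights {F g L V} rho h _.
Arguments root_system {F g} L h _.

Definition sum_spaces (F : fieldType) (g : vectType F) (I : eqType)
    (P : set I) (W : I -> set g) : set g :=
  [set x | exists (s : seq I) (f : I -> g),
     [/\ uniq s, forall i, i \in s -> P i /\ W i (f i)
       & x = \sum_(i <- s) f i]].

Section TwoStep.
Variables (F : fieldType) (g : vectType F) (L : lie_algebra g).
Variables (V : vectType F) (rho : lie_module L V).

Definition inV (v : V) : V * g := (v, 0).
Definition inG (x : g) : V * g := (0, x).

Definition admissible_form (B : {symmetric (V * g)%type}) : Prop :=
  [/\ nondegenerate B,
      forall v x, B (inV v) (inG x) = 0,
      forall x v v', B (inV (rho x v)) (inV v') + B (inV v) (inV (rho x v')) = 0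
    & forall x y z, B (inG (L x y)) (inG z) + B (inG y) (inG (L x z)) = 0].

Definition two_step_bracket (B : {symmetric (V * g)%type})
    (N : lie_algebra (V * g)%type) : Prop :=
  [/\ forall x w, N (inG x) w = 0,
      forall w w', exists z, N w w' = inG z
    & forall v v' z,
        B (N (inV v) (inV v')) (inG z) = B (inV (rho z v)) (inV v')].

Definition dual_vector (B : {symmetric (V * g)%type}) (h : {vspace g})
    (lambda : 'Hom(subvs_of h, F^o)) (t : subvs_of h) : Prop :=
  forall H : subvs_of h, B (inG (vsval H)) (inG (vsval t)) = lambda H.

Definition target_space (h : {vspace g}) (lambda : 'Hom(subvs_of h, F^o))
    (t : subvs_of h) : set g :=
  [set x | exists (c : F) (y z : g),
     [/\ root_space L lambda y,
         sum_spaces (roots_below rho lambda) (@root_space F g L h) z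
       & x = c *: vsval t + y + z]].

End TwoStep.

(* Main.v *)
From HB Require Import structures.
Require Import Defs.
From mathcomp Require Import all_boot all_order all_algebra.
From mathcomp Require Import all_classical reals complex.
Import GRing.Theory.
Local Open Scope classical_set_scope.
Local Open Scope ring_scope.
Set Implicit Arguments.
Unset Strict Implicit.
Unset Printing Implicit Defensive.

(** Write [[v, w] = phi w] for the linear map [phi : V -> g] induced by [ad v].
The relation [B (phi w) z = B (z v) w] makes the image of [phi] the orthogonal
of the annihilator [{z | z v = 0}] of [v] in [g], so both claims become
statements about which elements of [g] annihilate [v].

Inclusion.  Since [B] is invariant, it pairs the weight space of [mu] only with
the one of [- mu], and does so perfectly ([weight_orthogonal],
[weight_nondegenerate]).  For [z] of weight [- mu] the vector [z v] has weight
[lambda - mu]; hence the [mu]-component of [phi w] is zero as soon as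
[lambda - mu] is not a weight.  The component of weight zero lies in [h] and
pairs with [H] as [lambda H * B v w], so it is a multiple of [t].

Equality.  Let [z] annihilate [v].  The components of [z] move [v] into distinct
weight spaces, so each of them annihilates [v] ([annihilator_component]).  As
[v] is nonzero, the component in [h] is in the kernel of [lambda], that is,
orthogonal to [t].  The component in the root space of [- alpha] is zero for
every [alpha] occurring in the target: root spaces are lines
([root_space_line]), so otherwise [X (- alpha)] would kill [v], and [v] would
be singular.  Therefore [t] and those root spaces are orthogonal to the
annihilator of [v], that is, they lie in the image of [phi].  That [v] is
nonzero comes from [roots_below_nonempty]: the singular set contains [0].

The root theory rests on the invariant form [b] and on the triviality of the
center, which semisimplicity provides. Simultaneous diagonalization decomposes
[g]; maximality of [h] among abelian subspaces makes [h] the weight space of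
[0]. That root spaces are lines follows from one computation along root
strings, [root_string_unbounded]: a vector killed by [y] that is raised by [x],
with [[x, y] = K], generates an infinite string unless some partial sum of the
values of the weights at [K] vanishes. *)

(** * Joint eigenvectors of commuting operators *)

Section LinearAlgebra.
Variables (F : fieldType) (M : vectType F).

(** If [f j0] is a further term of a vanishing sum, then applying
[A i - chi j0 i] removes it and multiplies each [f j] by [chi j i - chi j0 i];
choosing [i] that separates [j] from [j0] gives the induction. *)
Lemma eigen_indep (I : Type) (J : eqType) (A : I -> {linear M -> M})
    (chi : J -> I -> F) :
  (forall j k, (forall i, chi j i = chi k i) -> j = k) ->
  forall (s : seq J) (f : J -> M), uniq s ->
    (forall j, j \in s -> forall i, A i (f j) = chi j i *: f j) ->
    \sum_(j <- s) f j = 0 -> forall j, j \in s -> f j = 0.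
Proof.
move=> chi_inj; elim=> [|j0 s IHs] f //= /andP[j0s s_uniq] fE.
rewrite big_cons => sum0.
have tail0 j : j \in s -> f j = 0.
  move=> js; apply/eqP/negP => /negP fj_neq0.
  suff jE : j = j0 by rewrite -jE js in j0s.
  apply: chi_inj => i; apply/eqP; rewrite -subr_eq0.
  have /eqP : (chi j i - chi j0 i) *: f j = 0.
    apply: (IHs (fun k => (chi k i - chi j0 i) *: f k) s_uniq _ _ j js).
      move=> k ks i'; rewrite linearZ_LR /= fE ?inE ?ks ?orbT //.
      by rewrite !scalerA mulrC.
    have : A i (f j0 + \sum_(k <- s) f k)
           - chi j0 i *: (f j0 + \sum_(k <- s) f k) = 0.
      by rewrite sum0 linear0 scaler0 subr0.
    rewrite linearD fE ?mem_head // scalerDr opprD addrACA subrr add0r.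
    rewrite linear_sum scaler_sumr -sumrB => sumE; rewrite -[RHS]sumE.
    apply: eq_big_seq => k ks.
    by rewrite scalerBl fE // inE ks orbT.
  by rewrite scaler_eq0 (negPf fj_neq0) orbF.
move=> j; rewrite inE => /orP[/eqP->|/tail0 //].
by move: sum0; rewrite big_seq big1 ?addr0 // => k /tail0.
Qed.

(** Turns a sum of vectors that each satisfy some [P j] into a sum with at most
one term for each index, the form to which independence results apply. *)
Lemma collect_by_index (J : eqType) (P : J -> M -> Prop) :
  (forall j, P j 0) -> (forall j x y, P j x -> P j y -> P j (x + y)) ->
  forall (ys : seq M) (j : M -> J), (forall y, y \in ys -> P (j y) y) ->
    exists (s : seq J) (f : J -> M),
    [/\ uniq s, forall k, P k (f k) & \sum_(y <- ys) y = \sum_(k <- s) f k].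
Proof.
move=> P0 PD ys j Pj.
exists (undup (map j ys)), (fun k => \sum_(y <- ys | j y == k) y).
split; first exact: undup_uniq.
  move=> k; rewrite big_seq_cond.
  elim/big_rec: _ => [//|y x /andP[yys /eqP jy] Px].
  by apply: PD => //; rewrite -jy; apply: Pj.
rewrite (exchange_big_dep predT) //=; apply: eq_big_seq => y yys.
rewrite -big_filter (eq_filter (a2 := pred1 (j y))); last first.
  by move=> k; rewrite /= eq_sym.
rewrite filter_pred1_uniq ?undup_uniq ?mem_undup ?map_f //.
by rewrite big_seq1.
Qed.

Definition sum_of_eigenvectors (ops : seq 'End(M)) (x : M) : Prop :=
  exists2 ys : seq M,
    forall y, y \in ys -> forall A, A \in ops -> exists a, A y = a *: y
    & x = \sum_(y <- ys) y.

Lemma sum_of_eigenvectors_sum (ops : seq 'End(M)) (ys : seq M) :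
  (forall y, y \in ys -> sum_of_eigenvectors ops y) ->
  sum_of_eigenvectors ops (\sum_(y <- ys) y).
Proof.
elim: ys => [|y ys IH] Hys; first by exists [::]; rewrite ?big_nil.
have [|zs zsP zsE] := IH; first by move=> z zys; apply: Hys; rewrite inE zys orbT.
have [us usP usE] := Hys y (mem_head _ _).
exists (us ++ zs); last by rewrite big_cons big_cat /= -usE -zsE.
by move=> z; rewrite mem_cat => /orP[/usP|/zsP].
Qed.

(** Split a joint eigenvector [y] of the other operators along the eigenspaces
of [A]. The eigenvector equation [B y = d *: y] splits along them too because [B]
commutes with [A], so each component is still an eigenvector of [B]. *)
Lemma simultaneous_eigenvectors (ops : seq 'End(M)) :
  (forall A B, A \in ops -> B \in ops -> forall x, A (B x) = B (A x)) ->
  (forall A, A \in ops -> forall x, sum_of_eigenvectors [:: A] x) ->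
  forall x, sum_of_eigenvectors ops x.
Proof.
elim: ops => [|A ops IH] comm diag x.
  by exists [:: x]; rewrite ?big_seq1.
have [||ys ysP ->] := IH _ _ x.
- by move=> B C Bo Co; apply: comm; rewrite inE ?Bo ?Co orbT.
- by move=> B Bo; apply: diag; rewrite inE Bo orbT.
apply: sum_of_eigenvectors_sum => y /ysP {ys ysP x} yP.
have [zs zsP yE] := diag A (mem_head _ _) y.
have zsP' z : exists a, z \in zs -> A z = a *: z.
  have [zzs|_] := boolP (z \in zs); last by exists 0.
  by have [a Aa] := zsP z zzs A (mem_head _ _); exists a.
have {zsP' zsP} [c cP] := choice zsP'.
have [|||s [f [s_uniq fE sumE]]] :=
  @collect_by_index F (fun a z => A z = a *: z) _ _ zs c.
- by move=> a; rewrite linear0 scaler0.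
- by move=> a z z' Az Az'; rewrite scalerDr -Az -Az' linearD.
- exact: cP.
rewrite yE sumE in yP *; exists (map f s); last by rewrite big_map.
move=> _ /mapP[a sa ->] B; rewrite inE => /orP[/eqP->|Bo]; first by exists a.
have [d Bd] := yP B Bo; exists d; apply/eqP; rewrite -subr_eq0; apply/eqP.
pose id1 (_ : unit) : {linear M -> M} := A.
apply: (@eigen_indep unit F id1 (fun a _ => a) _ s
  (fun a => B (f a) - d *: f a)) => //.
- by move=> j k jk; exact: jk tt.
- move=> j js i; rewrite /id1 linearB linearZ_LR /= fE.
  rewrite (comm A B) ?mem_head ?inE ?Bo ?orbT // fE linearZ_LR /=.
  by rewrite scalerBr !scalerA mulrC.
- by move/eqP: Bd; rewrite -subr_eq0 linear_sum scaler_sumr -sumrB => /eqP.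
Qed.
End LinearAlgebra.

(** * Orthogonality for a nondegenerate form *)

Section Duality.
Variables (F : fieldType) (U W : vectType F) (b : {symmetric U}).
Hypothesis b_nd : forall x, (forall y, b x y = 0) -> x = 0.

Lemma functional_representation (l : 'Hom(U, F^o)) :
  exists z, forall x, l x = b x z.
Proof.
pose D : U -> 'Hom(U, F^o) := fun z => linfun (applyr b z : U -> F^o).
have D_lin : linear D.
  move=> a z z'; apply/lfunP => x.
  by rewrite lfunE add_lfunE scale_lfunE !lfunE /= linearDr linearZr_LR.
pose DL : {linear U -> 'Hom(U, F^o)} :=
  HB.pack D (GRing.isLinear.Build _ _ _ _ D D_lin).
have ker0 : lker (linfun DL) == 0%VS.
  rewrite -subv0; apply/subvP => z; rewrite memv_ker memv0 lfunE /= => /eqP Dz0.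
  apply/eqP; apply: b_nd => x; have /lfunP/(_ x) := Dz0.
  by rewrite !lfunE /= => xz; rewrite hermC expr0 mul1r.
have full : limg (linfun DL) = fullv.
  apply/eqP; rewrite -dimv_leqif_eq ?subvf // limg_dim_eq; last first.
    by rewrite (eqP ker0) capv0.
  by rewrite !dimvf /dim /= muln1.
have /memv_imgP[z _ ->] : l \in limg (linfun DL) by rewrite full memvf.
by exists z => x; rewrite lfunE /= /D lfunE.
Qed.

(** The double orthogonal of a subspace is the subspace itself. A coordinate of
the part of [x] outside the image of [phi] is a functional vanishing on that
image, hence of the form [b _ z] with [z] orthogonal to the image. *)
Lemma limg_double_orthogonal (phi : 'Hom(W, U)) (x : U) :
  (forall z, (forall w, b (phi w) z = 0) -> b x z = 0) -> x \in limg phi.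
Proof.
move=> orth; pose p := projv (limg phi).
suff -> : x = p x by exact: memv_proj.
apply/eqP; rewrite -subr_eq0; apply/eqP.
rewrite [LHS](coord_vbasis (memvf _)) big1 // => i _.
pose l : 'Hom(U, F^o) := (linfun (coord (vbasis {:U}) i : U -> F^o) \o (\1 - p))%VF.
have lE y : l y = coord (vbasis fullv) i (y - p y).
  by rewrite comp_lfunE lfunE add_lfunE opp_lfunE id_lfunE.
have [z lz] := functional_representation l.
rewrite -lE lz orth ?scale0r // => w.
by rewrite -lz lE /p projv_id ?subrr ?linear0 // memv_img ?memvf.
Qed.
End Duality.

(** * Weight spaces *)

Section Weights.
Variables (F : fieldType) (g : vectType F) (L : lie_algebra g).
Variables (h : {vspace g}).
Implicit Types (mu nu alpha : 'Hom(subvs_of h, F^o)).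

Lemma bracketC x y : L x y = - L y x.
Proof.
apply/eqP; rewrite -addr_eq0; apply/eqP.
have := lie_alternating L (x + y).
by rewrite linearDl !linearDr !lie_alternating add0r addr0.
Qed.

Lemma adjoint_actionP x y z : L (L x y) z = L x (L y z) - L y (L x z).
Proof.
have := lie_jacobi L x y z; rewrite (bracketC z x) (bracketC z (L x y)) linearNr.
by move/eqP; rewrite subr_eq0 => /eqP.
Qed.

(** Makes [ad_weight_space] an instance of [weight_space], so that the lemmas
below cover weights of modules and roots alike. *)
Definition adjoint : lie_module L g := LieModule adjoint_actionP.

Section Module.
Variables (V : vectType F) (rho : lie_module L V).

Lemma weight_space0 mu : weight_space rho mu 0.
Proof. by move=> H; rewrite linear0r scaler0. Qed.

Lemma weight_spaceD mu v w :
  weight_space rho mu v -> weight_space rho mu w -> weight_space rho mu (v + w).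
Proof. by move=> Vv Vw H; rewrite linearDr Vv Vw scalerDr. Qed.

Lemma weight_spaceZ mu a v :
  weight_space rho mu v -> weight_space rho mu (a *: v).
Proof. by move=> Vv H; rewrite linearZr_LR /= Vv !scalerA mulrC. Qed.

Lemma weight_space_action alpha mu x v :
  ad_weight_space L alpha x -> weight_space rho mu v ->
  weight_space rho (mu + alpha) (rho x v).
Proof.
move=> gx Vv H; have := lie_actionP rho (vsval H) x v.
rewrite gx Vv linearZl_LR linearZr_LR /= => /eqP.
by rewrite eq_sym subr_eq addrC -scalerDl add_lfunE => /eqP.
Qed.

(** The injective reindexing [chi] serves two purposes: weights shifted by
a fixed weight, and the weights of a root string. *)
Lemma weight_indep (J : eqType) (chi : J -> 'Hom(subvs_of h, F^o))
    (s : seq J) (f : J -> V) :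
  injective chi -> uniq s ->
  (forall j, j \in s -> weight_space rho (chi j) (f j)) ->
  \sum_(j <- s) f j = 0 -> forall j, j \in s -> f j = 0.
Proof.
pose A (H : subvs_of h) : {linear V -> V} := rho (vsval H).
move=> chi_inj s_uniq fE.
apply: (@eigen_indep _ _ _ _ A (fun j H => chi j H)) => // j k jk.
by apply: chi_inj; apply/lfunP.
Qed.

Lemma weight_space_neq0 mu :
  weight_space rho mu <> [set 0] -> exists2 v, weight_space rho mu v & v <> 0.
Proof.
move=> Vmu; apply: contrapT => no; apply: Vmu; rewrite eqEsubset; split=> v /=.
  by move=> Vv; apply: contrapT => v0; apply: no; exists v.
by move->; exact: weight_space0.
Qed.
End Module.
End Weights.
Arguments adjoint {F g} L.
Arguments weight_space0 {F g L h V} rho mu.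

(** * Roots with respect to an invariant form *)

Section RootTheory.
Variables (F : numFieldType) (g : vectType F) (L : lie_algebra g).
Variables (h : {vspace g}) (b : {symmetric g}).
Hypothesis L_ss : is_semisimple L.
Hypothesis h_cartan : is_cartan L h.
Hypothesis b_nd : forall x, (forall y, b x y = 0) -> x = 0.
Hypothesis b_inv : forall x y z, b (L x y) z + b y (L x z) = 0.
Implicit Types (mu nu alpha beta : 'Hom(subvs_of h, F^o)) (x y z : g).
Local Notation weight := 'Hom(subvs_of h, F^o).
Local Notation gw := (@ad_weight_space F g L h).

Lemma form_sym x y : b x y = b y x.
Proof. by rewrite hermC expr0 mul1r. Qed.

(** A central vector spans an abelian ideal. *)
Lemma center_trivial z : (forall y, L z y = 0) -> z = 0.
Proof.
move=> zC; apply/eqP; rewrite -memv0 -[0%VS](L_ss (I := <[z]>%VS)) ?memv_line //.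
  move=> x y /vlineP[a ->].
  by rewrite linearZr_LR /= bracketC zC oppr0 scaler0 mem0v.
exists 1%N; apply/eqP; rewrite -subv0.
apply/span_subvP => _ /allpairsP[[x y] /= [xz yz ->]].
have /vlineP[a ->] := vbasis_mem xz.
by rewrite linearZl_LR /= zC scaler0 mem0v.
Qed.

(** Adding to [h] a vector that commutes with it leaves it abelian. *)
Lemma weight_zero_cartan x : gw (0 : weight) x -> x \in h.
Proof.
move=> gx; have [h_ab h_max _] := h_cartan.
have xh y : y \in h -> L y x = 0.
  by move=> yh; rewrite -(vsprojK yh) gx zero_lfunE scale0r.
rewrite -(h_max (h + <[x]>)%VS) ?addvSl //.
  by rewrite (subvP (addvSr _ _)) ?memv_line.
move=> u u' /memv_addP[y1 y1h [_ /vlineP[a1 ->] ->]].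
move=> /memv_addP[y2 y2h [_ /vlineP[a2 ->] ->]].
rewrite linearDl !linearDr !linearZl_LR !linearZr_LR /= h_ab // xh //.
by rewrite bracketC xh // lie_alternating oppr0 !scaler0 !addr0.
Qed.

Lemma cartan_weight_zero x : x \in h -> gw (0 : weight) x.
Proof.
move=> xh H; have [h_ab _ _] := h_cartan.
by rewrite zero_lfunE scale0r h_ab ?subvsP.
Qed.

(** The eigenvalue is linear in the acting element because it is the coordinate
of the bracket on the line spanned by [y]. *)
Lemma weight_of_eigenvector y :
  (forall A, A \in [seq linfun (L x) | x <- vbasis h] -> exists a, A y = a *: y) ->
  exists mu : weight, gw mu y.
Proof.
have [-> _|y_neq0 yP] := eqVneq y 0.
  by exists 0; exact: (weight_space0 (adjoint L)).
pose l : subvs_of h -> F^o := coord [tuple y] ord0 \o applyr L y \o vsval.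
have fy : free [tuple y] by rewrite seq1_free.
exists (linfun l) => H; rewrite lfunE /l /=.
suff [a Ha] : exists a, L (vsval H) y = a *: y.
  rewrite Ha linearZ_LR /=; congr (_ *: _).
  by rewrite -[y in coord _ _ y]/([tuple y]`_(ord0 : 'I_1)) coord_free // mulr1.
rewrite (coord_vbasis (subvsP H)) linear_sumlz.
have /choice[c cP] (i : 'I_(\dim h)) : exists a, L (vbasis h)`_i y = a *: y.
  have [|a] := yP (linfun (L (vbasis h)`_i)); last by rewrite lfunE; exists a.
  by apply: (map_f (fun x => linfun (L x))); rewrite mem_nth ?size_tuple.
exists (\sum_i coord (vbasis h) i (vsval H) * c i); rewrite scaler_suml.
by apply: eq_bigr => i _; rewrite linearZl_LR /= cP scalerA.
Qed.

Lemma weight_decomposition x : sum_spaces [set: 'Hom(subvs_of h, F^o)] gw x.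
Proof.
have [h_ab _ h_diag] := h_cartan.
have [||ys ysP ->] := simultaneous_eigenvectors
  (ops := [seq linfun (L x) | x <- vbasis h]) _ _ x.
- move=> _ _ /mapP[y yh ->] /mapP[z zh ->] u; rewrite !lfunE /=.
  apply/eqP; rewrite -subr_eq0 -adjoint_actionP (h_ab y z) ?vbasis_mem //.
  by rewrite linear0l.
- move=> _ /mapP[y yh ->] u; have [bs bs_basis bsP] := h_diag y (vbasis_mem yh).
  pose bt := in_tuple bs.
  exists [seq coord bt i u *: bs`_i | i <- enum 'I_(size bs)].
    move=> _ /mapP[i _ ->] A; rewrite inE => /eqP ->; rewrite lfunE /=.
    have [|a ya] := bsP bs`_i; first exact: mem_nth.
    by exists a; rewrite linearZr_LR /= ya !scalerA mulrC.
  by rewrite big_map big_enum /= [LHS](coord_basis (X := bt) bs_basis) ?memvf.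
have wt y : exists mu : weight, y \in ys -> gw mu y.
  have [yys|_] := boolP (y \in ys); last by exists 0.
  by have [mu] := weight_of_eigenvector (ysP _ yys); exists mu.
have [m mP] := choice wt.
have [|||s [f [s_uniq fP ->]]] := @collect_by_index F g _ gw _ _ ys m.
- exact: (weight_space0 (adjoint L)).
- by move=> mu u u'; exact: (@weight_spaceD _ _ _ _ _ (adjoint L)).
- exact: mP.
- by exists s, f; split.
Qed.

Lemma weight_orthogonal alpha beta x y :
  gw alpha x -> gw beta y -> alpha + beta <> 0 -> b x y = 0.
Proof.
move=> gx gy ab; apply/eqP/negP => /negP bxy; apply: ab.
apply/lfunP => H; rewrite add_lfunE zero_lfunE; apply/eqP.
have /eqP := b_inv (vsval H) x y.
by rewrite gx gy linearZl_LR linearZr_LR /= -mulrDl mulf_eq0 (negPf bxy) orbF.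
Qed.

(** The other weight components of a test vector are orthogonal to [x]. *)
Lemma weight_nondegenerate alpha x : gw alpha x ->
  (forall y, gw (- alpha) y -> b x y = 0) -> x = 0.
Proof.
move=> gx x_orth; apply: b_nd => y.
have [s [f [_ fP ->]]] := weight_decomposition y.
rewrite linear_sumr big_seq big1 // => mu /fP[_ gf].
have [mua|mua] := eqVneq mu (- alpha); first by apply: x_orth; rewrite -mua.
by apply: weight_orthogonal gx gf _ => /eqP; rewrite addrC addr_eq0 (negPf mua).
Qed.

Lemma root_dual alpha x : gw alpha x -> x <> 0 ->
  exists2 y, gw (- alpha) y & b x y != 0.
Proof.
move=> gx x0; apply: contrapT => no; apply: x0.
apply: weight_nondegenerate gx _ => y gy.
by apply/eqP/negP => /negP bxy; apply: no; exists y.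
Qed.

Lemma cartan_nondegenerate x : x \in h ->
  (forall H : subvs_of h, b x (vsval H) = 0) -> x = 0.
Proof.
move=> xh x_orth; apply: weight_nondegenerate (cartan_weight_zero xh) _ => y.
by rewrite oppr0 => /weight_zero_cartan yh; rewrite -(vsprojK yh).
Qed.

Lemma cartan_faithful (H : subvs_of h) :
  (forall mu y, gw mu y -> mu H *: y = 0) -> vsval H = 0.
Proof.
move=> H0; apply: center_trivial => y.
have [s [f [_ fP ->]]] := weight_decomposition y.
rewrite linear_sumr big_seq big1 // => mu /fP[_ gf].
by rewrite gf; exact: H0.
Qed.

Lemma bracket_cartan alpha x y : gw alpha x -> gw (- alpha) y -> L x y \in h.
Proof.
move=> gx gy; apply: weight_zero_cartan; rewrite -(addNr alpha).
exact: (weight_space_action (rho := adjoint L)).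
Qed.

Lemma bracket_form alpha x y (H : subvs_of h) : gw (- alpha) y ->
  b (L x y) (vsval H) = alpha H * b x y.
Proof.
move=> gy; have /eqP := b_inv y x (vsval H); rewrite addrC addr_eq0 => /eqP E.
rewrite (bracketC L x) linearNl -E (bracketC L y) gy opp_lfunE scaleNr opprK.
by rewrite linearZr_LR.
Qed.

Lemma lfun_mulrn alpha n (H : subvs_of h) : (alpha *+ n) H = alpha H *+ n.
Proof. by elim: n => [|n IH]; rewrite ?zero_lfunE // !mulrSr add_lfunE IH. Qed.

Lemma mulrn_inj_eq0 (a : F) (m n : nat) : a *+ m = a *+ n -> m != n -> a = 0.
Proof.
move=> amn; have /eqP : a * (m%:R - n%:R) = 0.
  by rewrite mulrBr !mulr_natr amn subrr.
rewrite mulf_eq0 => /orP[/eqP //|]; rewrite subr_eq0 Num.Theory.eqr_nat.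
by move=> /eqP ->; rewrite eqxx.
Qed.

(** The weights [mu + alpha *+ n] are pairwise distinct when [alpha] is nonzero,
so the [z n] would be an infinite independent family. *)
Lemma infinite_weight_chain alpha mu (z : nat -> g) :
  (forall n, gw (mu + alpha *+ n) (z n)) -> (forall n, z n != 0) -> alpha = 0.
Proof.
move=> gz z_neq0; apply/eqP/negP => /negP a_neq0.
pose N := (\dim {:g}).+1.
have zfree : free [tuple z i | i < N].
  apply/freeP => c /= sum0 i.
  have /eqP : c i *: z i = 0.
    apply: (@weight_indep _ _ _ _ _ (adjoint L) 'I_N (fun j => mu + alpha *+ j)
      (enum 'I_N) (fun j => c j *: z j)).
    - move=> j k /addrI jk; apply: contraNeq a_neq0 => jNk; apply/eqP/lfunP => H.
      apply/eqP; rewrite zero_lfunE; have := congr1 (fun l : weight => l H) jk.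
      by rewrite !lfun_mulrn => /mulrn_inj_eq0 ->.
    - exact: enum_uniq.
    - by move=> j _; apply: (weight_spaceZ (rho := adjoint L)); exact: gz.
    - rewrite big_enum /= -[RHS]sum0; apply: eq_bigr => j _.
      by rewrite (nth_map j) ?size_enum_ord // nth_ord_enum.
    - by rewrite mem_enum.
  by rewrite scaler_eq0 (negPf (z_neq0 i)) orbF => /eqP.
move: zfree; rewrite /free size_tuple => /eqP dimN.
by have := dimvS (subvf <<[tuple z i | i < N]>>); rewrite dimN ltnn.
Qed.

Lemma weight_iter alpha mu x w n : gw alpha x -> gw mu w ->
  gw (mu + alpha *+ n) (iter n (L x) w).
Proof.
move=> gx gw_w; elim: n => [|n IH]; first by rewrite mulr0n addr0.
rewrite mulrSr addrA; exact: (weight_space_action (rho := adjoint L) gx IH).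
Qed.

(** With [z n] the [n]-th iterate of [ad x] on [w], commuting [y] past the
powers of [ad x] gives [[y, z (n + 1)] = - S n *: z n], where [S n] is the sum
of the values [(mu + alpha *+ k) K] for [k <= n]. If no [S n] vanishes then no
[z n] does either, and the string of weights is infinite. *)
Lemma root_string_unbounded alpha mu x y w (K : subvs_of h) :
  gw alpha x -> L x y = vsval K -> gw mu w -> w <> 0 -> L y w = 0 ->
  (forall n, \sum_(k < n.+1) (mu + alpha *+ k) K != 0) -> alpha = 0.
Proof.
move=> gx xyK gw_w w0 yw0 coef.
pose z n := iter n (L x) w.
have gz n : gw (mu + alpha *+ n) (z n) by exact: weight_iter.
have step n : L y (z n.+1) = L x (L y (z n)) - (mu + alpha *+ n) K *: z n.
  by rewrite -(gz n K) -xyK adjoint_actionP opprB addrC subrK.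
have yz n : L y (z n.+1) = - (\sum_(k < n.+1) (mu + alpha *+ k) K) *: z n.
  elim: n => [|n IH]; rewrite step.
    by rewrite yw0 linear0r sub0r big_ord1 scaleNr.
  by rewrite IH linearZr_LR -scalerBl [in RHS]big_ord_recr opprD.
apply: infinite_weight_chain gz _; elim=> [|n IH]; first exact/eqP.
apply/negP => /eqP z0; have /eqP := yz n.
by rewrite z0 linear0r eq_sym scaler_eq0 oppr_eq0 (negPf (coef n)) (negPf IH).
Qed.

(** Lowering by [y] has to stop; the last nonzero vector is the starting point
that [root_string_unbounded] requires. *)
Lemma string_bottom alpha mu y u : alpha <> 0 -> gw (- alpha) y ->
  gw mu u -> u <> 0 ->
  exists n w, [/\ gw (mu - alpha *+ n) w, w <> 0 & L y w = 0].
Proof.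
move=> a0 gy gu u0; apply: contrapT => no; apply: a0; apply: oppr_inj.
rewrite oppr0; apply: (@infinite_weight_chain _ mu (fun n => iter n (L y) u)).
  by move=> n; exact: weight_iter.
elim=> [|n /eqP IH]; first exact/eqP.
apply/eqP => un0; apply: no; exists n, (iter n (L y) u); split=> //.
by rewrite -mulNrn; exact: weight_iter.
Qed.

(** If [alpha K = 0], every weight takes a constant value at [K] along its
[alpha]-string. A nonzero value would make the string infinite, so [K] acts by
zero on [g] and is zero, although [b K H] is a nonzero multiple of [alpha H]. *)
Lemma root_nonisotropic alpha x y (K : subvs_of h) :
  alpha <> 0 -> gw alpha x -> gw (- alpha) y -> b x y != 0 ->
  L x y = vsval K -> alpha K != 0.
Proof.
move=> a0 gx gy bxy xyK; apply/negP => /eqP aK0; apply: (a0); apply/lfunP => H.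
have K0 : vsval K = 0.
  apply: cartan_faithful => mu u gu; apply: contrapT => /eqP.
  rewrite scaler_eq0 negb_or => /andP[muK /eqP u0].
  have [n [w [gw_w w0 yw0]]] := string_bottom a0 gy gu u0.
  apply: a0; apply: root_string_unbounded gx xyK gw_w w0 yw0 _ => m.
  rewrite (eq_bigr (fun=> mu K)) => [|k _].
    by rewrite sumr_const card_ord Num.Theory.mulrn_eq0.
  by rewrite !add_lfunE opp_lfunE !lfun_mulrn aK0 !mul0rn subr0 addr0.
have /eqP := bracket_form x H gy.
by rewrite xyK K0 linear0l eq_sym mulf_eq0 (negPf bxy) orbF zero_lfunE => /eqP.
Qed.

(** Subtracting a multiple of [x] from [z] gives [w] in the root space of
[alpha] that is orthogonal to [y], hence killed by [y]. The string through [w]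
starts at [alpha] itself, and its partial sums at [K = [x, y]] are the positive
multiples [1 + 2 + ... + (n + 1)] of [alpha K], so [w] must be zero. *)
Lemma root_space_line alpha x z : alpha <> 0 -> gw alpha x -> x <> 0 ->
  gw alpha z -> exists a, z = a *: x.
Proof.
move=> a0 gx x0 gz; have [y gy bxy] := root_dual gx x0.
exists (b z y / b x y); apply/eqP; rewrite -subr_eq0; apply/eqP.
set w := z - _; apply: contrapT => w0; apply: (a0).
have gw_w : gw alpha w.
  rewrite /w -scaleNr; apply: (weight_spaceD (rho := adjoint L)) => //.
  exact: (weight_spaceZ (rho := adjoint L)).
have bwy : b w y = 0 by rewrite linearBl linearZl_LR /= divfK // subrr.
have yw0 : L y w = 0.
  rewrite bracketC (cartan_nondegenerate (bracket_cartan gw_w gy)) ?oppr0 // => H.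
  by rewrite (bracket_form _ _ gy) bwy mulr0.
pose K := vsproj h (L x y).
have xyK : L x y = vsval K by rewrite vsprojK // (bracket_cartan gx gy).
apply: (root_string_unbounded gx xyK gw_w w0 yw0) => n.
rewrite (eq_bigr (fun k : 'I_n.+1 => alpha K *+ k.+1)) => [|k _].
  rewrite sumrMnr Num.Theory.mulrn_eq0 negb_or.
  rewrite (root_nonisotropic a0 gx gy bxy xyK) andbT.
  by rewrite big_ord_recl.
by rewrite add_lfunE lfun_mulrn mulrS.
Qed.

Lemma root_systemI alpha x : alpha <> 0 -> gw alpha x -> x <> 0 ->
  root_system L h alpha.
Proof. by move=> a0 gx x0; split=> // gw0; apply: x0; rewrite gw0 in gx. Qed.

Lemma root_space_weight alpha x : root_space L alpha x -> gw alpha x.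
Proof.
rewrite /root_space; case: ifP => // _ ->; exact: (weight_space0 (adjoint L)).
Qed.

Lemma root_spaceE alpha x : alpha <> 0 -> gw alpha x -> root_space L alpha x.
Proof.
move=> a0 gx; rewrite /root_space; case: ifPn => [//|/negP aN].
apply: contrapT => x0; apply: aN; rewrite inE; exact: root_systemI a0 gx x0.
Qed.

Lemma cartan_roots_faithful (H : subvs_of h) :
  (forall alpha, root_system L h alpha -> alpha H = 0) -> vsval H = 0.
Proof.
move=> H0; apply: cartan_faithful => mu y gy.
have [->|y0] := eqVneq y 0; first by rewrite scaler0.
have [->|mu0] := eqVneq mu 0; first by rewrite zero_lfunE scale0r.
rewrite H0 ?scale0r //; exact: root_systemI (elimN eqP mu0) gy (elimN eqP y0).
Qed.

(** Otherwise all root vectors kill [v], and so do the brackets [[x, y]] of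
opposite root vectors, on which [lambda] takes the value [alpha t * b x y]. Thus
every root vanishes at [t], which is then central, and [lambda] is zero. *)
Lemma roots_below_nonempty (V : vectType F) (rho : lie_module L V)
    (lambda : weight) (t : subvs_of h) (v : V) :
  lambda <> 0 -> (forall H : subvs_of h, b (vsval H) (vsval t) = lambda H) ->
  weight_space rho lambda v -> v <> 0 ->
  exists alpha, roots_below rho lambda alpha.
Proof.
move=> l0 t_dual Vv v0; apply: contrapT => no.
have kill alpha y : root_system L h alpha -> gw (- alpha) y -> rho y v = 0.
  move=> Ra gy; apply: contrapT => yv0; apply: no; exists alpha; split=> // V0.
  by apply: yv0; have := weight_space_action gy Vv; rewrite V0.
suff t0 : vsval t = 0.
  by apply: l0; apply/lfunP => H; rewrite -t_dual t0 linear0r zero_lfunE.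
apply: cartan_roots_faithful => alpha [a0].
move=> /(weight_space_neq0 (rho := adjoint L))[x gx x0].
have [y gy bxy] := root_dual gx x0.
have Ra : root_system L h alpha by exact: root_systemI gx x0.
have RNa : root_system L h (- alpha).
  apply: (root_systemI _ gy) => [/eqP|y0]; first by rewrite oppr_eq0 => /eqP.
  by rewrite y0 linear0r eqxx in bxy.
have xv0 : rho x v = 0 by apply: kill RNa _; rewrite opprK.
have := lie_actionP rho x y v; rewrite xv0 (kill alpha y) // !linear0r subr0.
rewrite -(vsprojK (bracket_cartan gx gy)) Vv => /eqP.
rewrite scaler_eq0 (introF eqP v0) orbF -t_dual vsprojK ?(bracket_cartan gx gy) //.
by rewrite (bracket_form _ _ gy) mulf_eq0 (negPf bxy) orbF => /eqP.
Qed.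
End RootTheory.

(** * The form and the bracket of the two-step nilpotent algebra *)

Section Pullback.
Variables (F : fieldType) (U W : lmodType F) (B : {symmetric W}).
Variable f : {linear U -> W}.

Definition pullback (x y : U) : F := B (f x) (f y).

Lemma pullback_bilinear : bilinear_for *%R (idfun \; *%R) pullback.
Proof.
split=> u a x y; rewrite /pullback linearP.
  by rewrite linearDl linearZl_LR.
by rewrite linearDr linearZr_LR.
Qed.

HB.instance Definition _ :=
  bilinear_isBilinear.Build F U U F *%R (idfun \; *%R) pullback pullback_bilinear.

Lemma pullback_sym x y : pullback x y = (-1) ^+ false * idfun (pullback y x).
Proof. exact: hermC. Qed.

HB.instance Definition _ :=
  isHermitianSesquilinear.Build F U false idfun pullback pullback_sym.
End Pullback.

Section TwoStep.
Variables (F : numFieldType) (g V : vectType F).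

Lemma inG_linear : linear (@inG F g V).
Proof. by move=> a x y; congr (_, _) => /=; rewrite scaler0 addr0. Qed.
HB.instance Definition _ :=
  GRing.isLinear.Build F g (V * g)%type _ (@inG F g V) inG_linear.

Lemma inV_linear : linear (@inV F g V).
Proof. by move=> a x y; congr (_, _) => /=; rewrite scaler0 addr0. Qed.
HB.instance Definition _ :=
  GRing.isLinear.Build F V (V * g)%type _ (@inV F g V) inV_linear.

Variables (L : lie_algebra g) (rho : lie_module L V).
Variables (B : {symmetric (V * g)%type}) (N : lie_algebra (V * g)%type).
Hypothesis B_adm : admissible_form rho B.
Hypothesis N_two_step : two_step_bracket rho B N.

Let b : {symmetric g} := pullback B (@inG F g V).
Let c : {symmetric V} := pullback B (@inV F g V).

Lemma b_nondegenerate x : (forall y, b x y = 0) -> x = 0.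
Proof.
move=> x_orth; have [B_nd B_VG _ _] := B_adm.
suff : inG V x \in (0 : {vspace V * g})%VS by rewrite memv0 => /eqP[].
rewrite -(eqP B_nd); apply/mem_orthovP => -[v y] _.
have -> : (v, y) = inV g v + inG V y by congr (_, _); rewrite /= ?addr0 ?add0r.
by rewrite linearDr [X in X + _]hermC expr0 mul1r B_VG add0r; exact: x_orth.
Qed.

Lemma c_nondegenerate v : (forall w, c v w = 0) -> v = 0.
Proof.
move=> v_orth; have [B_nd B_VG _ _] := B_adm.
suff : inV g v \in (0 : {vspace V * g})%VS by rewrite memv0 => /eqP[].
rewrite -(eqP B_nd); apply/mem_orthovP => -[w y] _.
have -> : (w, y) = inV g w + inG V y by congr (_, _); rewrite /= ?addr0 ?add0r.
by rewrite linearDr [X in _ + X]B_VG addr0; exact: v_orth.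
Qed.

Lemma b_invariant x y z : b (L x y) z + b y (L x z) = 0.
Proof. by have [_ _ _] := B_adm; apply. Qed.

(** The map [phi] of the introduction: [ad v] on [V], read in [g]. *)
Definition ad_map (v : V) : 'Hom(V, g) :=
  linfun (snd \o N (inV g v) \o @inV F g V).

Lemma bracketE v w : N (inV g v) (inV g w) = inG V (ad_map v w).
Proof.
have [_ N_g _] := N_two_step; have [z zE] := N_g (inV g v) (inV g w).
by rewrite lfunE /= zE.
Qed.

Lemma ad_map_form v w z : b (ad_map v w) z = c (rho z v) w.
Proof. by have [_ _ NB] := N_two_step; have := NB v w z; rewrite bracketE. Qed.

(** * The image of a weight vector under the adjoint map *)

Section Main.
Variables (h : {vspace g}) (lambda : 'Hom(subvs_of h, F^o)) (t : subvs_of h).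
Variables (X : 'Hom(subvs_of h, F^o) -> g) (v : V).
Hypothesis L_ss : is_semisimple L.
Hypothesis h_cartan : is_cartan L h.
Hypothesis lambda_weight : nonzero_weights rho h lambda.
Hypothesis t_dual : dual_vector B lambda t.
Hypothesis X_root : forall alpha, root_system L h alpha ->
  root_space L (- alpha) (X (- alpha)) /\ X (- alpha) <> 0.
Hypothesis v_weight : weight_space rho lambda v.

Let b_nd := b_nondegenerate.
Let b_inv := b_invariant.

Lemma dual_vector_form (H : subvs_of h) : b (vsval t) (vsval H) = lambda H.
Proof. by rewrite form_sym; exact: t_dual. Qed.

Lemma ad_map_form_component mu (s : seq 'Hom(subvs_of h, F^o)) f z w : uniq s ->
  (forall nu, nu \in s -> ad_weight_space L nu (f nu)) ->
  ad_map v w = \sum_(nu <- s) f nu -> mu \in s ->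
  ad_weight_space L (- mu) z -> b (f mu) z = c (rho z v) w.
Proof.
move=> s_uniq fP E mu_s gz; rewrite -ad_map_form E linear_sumlz (bigD1_seq mu) //=.
rewrite big_seq_cond big1 ?addr0 // => nu /andP[nu_s nu_mu].
apply: (weight_orthogonal b_inv (fP nu nu_s) gz).
by apply/eqP; rewrite subr_eq0.
Qed.

(** The term from the root space of [lambda] can be taken to be zero here: it
is already counted among the roots below [lambda] when the weight space of [0]
is nonzero, and the component of [ad_map v w] there is zero otherwise. *)
Lemma ad_map_target w : target_space rho lambda t (ad_map v w).
Proof.
have [s [f [s_uniq fP E]]] := weight_decomposition h_cartan (ad_map v w).
have {}fP nu : nu \in s -> ad_weight_space L nu (f nu) by move=> /fP[].
have comp := ad_map_form_component s_uniq fP E.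
pose r := [seq mu <- s | mu != 0 & f mu != 0].
have f0 mu : mu \in s -> mu = 0 -> f mu = c v w *: vsval t.
  move=> mu_s mu0; apply/eqP; rewrite -subr_eq0; apply/eqP.
  have gf : @ad_weight_space F g L h 0 (f mu)
    by have := fP mu mu_s; rewrite {1}mu0.
  apply: (cartan_nondegenerate h_cartan b_nd b_inv).
    by rewrite memvB ?memvZ ?subvsP ?(weight_zero_cartan h_cartan gf).
  move=> H; rewrite linearBl linearZl_LR /= dual_vector_form.
  rewrite (comp mu) //; last first.
    by rewrite mu0 oppr0; exact: (cartan_weight_zero h_cartan (subvsP H)).
  by rewrite v_weight linearZl_LR /= mulrC subrr.
(* At most one index contributes, but each would give a multiple of [t]. *)
have [a aE] : exists a, \sum_(mu <- s | mu == 0) f mu = a *: vsval t.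
  exists (\sum_(mu <- s | mu == 0) c v w); rewrite scaler_suml big_seq_cond.
  rewrite [RHS]big_seq_cond; apply: eq_bigr => mu /andP[mu_s /eqP mu0].
  exact: f0.
exists a, 0, (\sum_(mu <- r) f mu); split.
- rewrite /root_space; case: ifP => // _; exact: (weight_space0 (adjoint L)).
- exists r, f; split; rewrite ?filter_uniq // => mu.
  rewrite mem_filter => /andP[/andP[/eqP mu0 /eqP fmu0] mu_s].
  have gf := fP mu mu_s; split; last exact: root_spaceE.
  split; first exact: root_systemI gf fmu0.
  move=> V0; apply: fmu0.
  apply: (weight_nondegenerate h_cartan b_nd b_inv gf) => z gz.
  rewrite (comp mu) //; have := weight_space_action gz v_weight.
  by rewrite V0 /= => ->; rewrite linear0l.
- rewrite addr0 E (bigID (fun mu => mu == 0)) /= aE; congr (_ + _).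
  rewrite big_filter [RHS]big_mkcond [LHS]big_mkcond /=; apply: eq_bigr => mu _.
  by case: (mu == 0) => //=; case: (eqVneq (f mu) 0).
Qed.

(** By [ad_map_form] the orthogonal of the image is the annihilator of [v]. *)
Lemma in_ad_map_image x :
  (forall z, rho z v = 0 -> b x z = 0) -> x \in limg (ad_map v).
Proof.
move=> x_orth; apply: (limg_double_orthogonal b_nd) => z z_orth.
apply/x_orth/c_nondegenerate => w; by rewrite -ad_map_form.
Qed.

(** The vectors [f nu] send [v] into the distinct weight spaces of
[lambda + nu]. *)
Lemma annihilator_component z : rho z v = 0 ->
  exists (s : seq 'Hom(subvs_of h, F^o)) f,
  [/\ uniq s,
      forall nu, nu \in s -> ad_weight_space L nu (f nu) /\ rho (f nu) v = 0
    & z = \sum_(nu <- s) f nu].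
Proof.
move=> zv0; have [s [f [s_uniq fP E]]] := weight_decomposition h_cartan z.
have {}fP nu : nu \in s -> ad_weight_space L nu (f nu) by move=> /fP[].
exists s, f; split=> // nu nu_s; split; first exact: fP.
apply: (weight_indep (rho := rho) (chi := fun nu => lambda + nu) (s := s)
  (f := fun nu => rho (f nu) v)) => //.
- by move=> ka ka_s; apply: weight_space_action v_weight; exact: fP.
- by rewrite -linear_sumlz -E.
Qed.

Hypothesis v_regular : ~ singular_set rho X lambda v.

Lemma v_neq0 : v <> 0.
Proof.
move=> v0; apply: v_regular.
have [l0 /weight_space_neq0[v' v'_weight v'0]] := lambda_weight.
have [alpha al] :=
  roots_below_nonempty L_ss h_cartan b_nd b_inv l0 t_dual v'_weight v'0.
by right; exists alpha => //; split; rewrite // v0 linear0r.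
Qed.

Lemma v_not_ker alpha : root_system L h alpha ->
  alpha = lambda \/ roots_below rho lambda alpha -> rho (X (- alpha)) v <> 0.
Proof.
move=> Ra al Xv0; apply: v_regular; case: al => [E|al].
  left; rewrite E in Ra Xv0; rewrite ifT; first by split.
  by apply: mem_set.
by right; exists alpha.
Qed.

(** Only the component of an annihilating [z] in [h] pairs with [t]; it acts on
the nonzero vector [v] by its value under [lambda], which is that pairing. *)
Lemma t_in_image : vsval t \in limg (ad_map v).
Proof.
apply: in_ad_map_image => z /annihilator_component[s [f [_ fP ->]]].
rewrite linear_sumr big_seq big1 // => mu /fP[gf fv0].
have [mu0|/eqP mu0] := eqVneq mu 0; last first.
  apply: (weight_orthogonal b_inv (cartan_weight_zero h_cartan (subvsP t)) gf).
  by rewrite add0r.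
have fh : f mu \in h by apply: (weight_zero_cartan h_cartan); rewrite -{1}mu0.
move: fv0; rewrite -(vsprojK fh) v_weight => /eqP.
rewrite scaler_eq0 (introF eqP v_neq0) orbF => /eqP <-.
exact: dual_vector_form.
Qed.

(** Only the component of weight [- alpha] of an annihilating [z] pairs with [x],
and if it were nonzero then [X (- alpha)], being a multiple of it, would kill
[v]. *)
Lemma root_space_in_image alpha x : root_space L alpha x ->
  alpha = lambda \/ roots_below rho lambda alpha -> x \in limg (ad_map v).
Proof.
move=> rx al; have [aR|aN] := boolP (alpha \in root_system L h); last first.
  by move: rx; rewrite /root_space (negPf aN) => ->; exact: mem0v.
rewrite inE in aR; have [a0 _] := aR; have gx := root_space_weight rx.
apply: in_ad_map_image => z /annihilator_component[s [f [_ fP ->]]].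
rewrite linear_sumr big_seq big1 // => mu /fP[gf fv0].
have [am|am] := eqVneq (alpha + mu) 0; last first.
  by apply: (weight_orthogonal b_inv gx gf); apply/eqP.
have muE : mu = - alpha by apply/eqP; rewrite -addr_eq0 addrC am.
have [fmu0|/eqP fmu0] := eqVneq (f mu) 0; first by rewrite fmu0 linear0r.
have [rX X0] := X_root aR; have gX := root_space_weight rX.
rewrite muE in gf fv0 fmu0.
have Na0 : - alpha <> 0 by move/eqP; rewrite oppr_eq0 => /eqP.
have [k Xk] := root_space_line L_ss h_cartan b_nd b_inv Na0 gf fmu0 gX.
case: (v_not_ker aR al).
by rewrite Xk linearZl_LR /= fv0 scaler0.
Qed.

Lemma target_in_image x : target_space rho lambda t x -> x \in limg (ad_map v).
Proof.
move=> [a [y [z [ry [s [f [_ fP ->]]] ->]]]].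
rewrite memvD ?memvD ?memvZ ?t_in_image //.
  by apply: root_space_in_image ry _; left.
rewrite big_seq memv_suml // => mu /fP[bl rf].
  by apply: root_space_in_image rf _; right.
Qed.
End Main.
End TwoStep.

Unset Implicit Arguments.

Theorem proposition4p9 (R : realType) (g V : vectType R[i])
    (L : lie_algebra g) (rho : lie_module L V)
    (B : {symmetric (V * g)%type}) (N : lie_algebra (V * g)%type)
    (h : {vspace g}) (lambda : 'Hom(subvs_of h, R[i]^o)) (t : subvs_of h)
    (X : 'Hom(subvs_of h, R[i]^o) -> g) (v : V) :
  is_semisimple L ->
  admissible_form rho B ->
  two_step_bracket rho B N ->
  is_cartan L h ->
  nonzero_weights rho h lambda ->
  dual_vector B lambda t ->
  (forall alpha, root_system L h alpha ->
     root_space L (- alpha) (X (- alpha)) /\ X (- alpha) <> 0) ->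
  weight_space rho lambda v ->
  [set N (inV g v) (inV g w) | w in [set: V]]
    `<=` [set inG V x | x in target_space rho lambda t]
  /\ (~ singular_set rho X lambda v ->
      [set N (inV g v) (inV g w) | w in [set: V]]
        = [set inG V x | x in target_space rho lambda t]).
Proof.
move=> L_ss B_adm N_two h_cartan l_weight t_dual X_root v_weight.
have incl : [set N (inV g v) (inV g w) | w in [set: V]]
    `<=` [set inG V x | x in target_space rho lambda t].
  move=> _ [w _ <-]; exists (ad_map N v w); last by rewrite (bracketE N_two).
  exact: (ad_map_target B_adm N_two h_cartan t_dual v_weight).
split=> // v_regular; rewrite eqEsubset; split=> // _ [x /= xT <-].
have /memv_imgP[w _ ->] := target_in_image B_adm N_two L_ss h_cartan l_weight
  t_dual X_root v_weight v_regular xT.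
by exists w; rewrite ?(bracketE N_two).
Qed.
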